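(* Let $X_\bullet,Y_\bullet$ be simplicial sets and let $\mathcal H:X_\bullet\times\Delta[1]\to Y_\bullet$ be a simplicial homotopy from $f$ to $g$. For $0\le j\le n$ let $\lambda_j:[n+1]\to[1]$ take the value $0$ on $0,\dots,j$ and $1$ on $j+1,\dots,n+1$, and for $\sigma\in X_n$ set $h_j(\sigma)=\mathcal H_{n+1}(s_j\sigma,\lambda_j)\in Y_{n+1}$. Let $V$ be a strictly unital normalized infinity-local system on $Y_\bullet$ with structure maps $F_m$. Define $$q_0(x)=F_1(h_0x),\qquad q_n(\sigma)=\sum_{j=0}^n(-1)^jF_{n+1}(h_j\sigma)\quad(n\ge1).$$ Then $q=\{q_n\}$ is a strictly unital normalized closed degree-zero morphism $q:g^*V\to f^*V$. If $\mathcal H$ is plot-smooth and $V$ is smooth, then $q$ is a raw plot-smooth morphism.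
   Context: A strictly unital normalized infinity-local system $V$ on a simplicial set $Y_\bullet$ consists of real cochain complexes $(V_y,d_V)$, $y\in Y_0$, and for $n\ge1$, $\sigma\in Y_n$ with vertices $\sigma(v_0),\dots,\sigma(v_n)$, maps $F_n(\sigma):V_{\sigma(v_n)}\to V_{\sigma(v_0)}$ of degree $1-n$ with $F_1(s_0y)=\mathrm{Id}$, $F_n(s_i\sigma)=0$ for $n>1$, and for all $n\ge1$ $$d_VF_n(\sigma)-(-1)^{1-n}F_n(\sigma)d_V+\sum_{l=1}^{n-1}(-1)^{l+n}F_{n-1}(\partial_l\sigma)+\sum_{p+r=n,\ p,r\ge1}(-1)^{p(1-r)}F_p(\sigma|_{[v_0..v_p]})F_r(\sigma|_{[v_p..v_n]})=0 .$$ Pullback along a simplicial map is by precomposition: $(f^*V)_x=V_{f(x)}$, $(f^*F)_n(\sigma)=F_n(f\sigma)$. Here $f$ and $g$ are the restrictions of $\mathcal H$ to the vertices $0$ and $1$ of $\Delta[1]$. A normalized degree-zero morphism $a:V\to W$ (structure maps $F$ on $V$, $G$ on $W$) on $X_\bullet$ is a family $a_n(\sigma):V_{\sigma(v_n)}\to W_{\sigma(v_0)}$, $n\ge0$, of degree $-n$, vanishing on degenerate simplices for $n\ge1$. With the sign convention used here it is closed if for all $n\ge0$ $$(-1)^n\bigl(d_Wa_n(\sigma)-(-1)^na_n(\sigma)d_V\bigr)+\sum_{l=1}^{n-1}(-1)^la_{n-1}(\partial_l\sigma)+\sum_{p+r=n,\,p\ge1}(-1)^{(1-p)r}G_p(\sigma|_{[v_0..v_p]})a_r(\sigma|_{[v_p..v_n]})-\sum_{p+r=n,\,r\ge1}(-1)^{pr}a_p(\sigma|_{[v_0..v_p]})F_r(\sigma|_{[v_p..v_n]})=0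 .$$ ''Strictly unital'' for the morphism $q$ refers to its being formed using the strictly unital structure maps of $V$ (degenerate edges acting as identities); in particular for the constant homotopy $q$ is the identity. For the smoothness assertion: $X_n,Y_n$ carry diffeologies (classes of plots from finite-dimensional manifolds) for which faces and degeneracies are smooth, with $X_0$, $Y_0$ manifolds (for example the spaces of smooth foliated simplices $\Delta^n\to M$, tangent to a regular foliation of $M$, with plots the families having smooth adjoint $S\times\Delta^n\to M$). $\mathcal H$ is plot-smooth if it sends plots to plots. $V$ is smooth if the $V_y$ are the fibers of a bounded graded finite-rank smooth vector bundle on $Y_0$ with smooth differential and each $F_n$ depends smoothly on the parameter along every plot; a morphism is raw plot-smooth if each $a_n$ depends smoothly on the parameter along every plot. *)

(* Defs.v *)
From HB Require Import structures.
From mathcomp Require Import all_boot all_order all_algebra.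
From mathcomp Require Import all_classical all_reals all_analysis.

Set Implicit Arguments.
Unset Strict Implicit.
Unset Printing Implicit Defensive.

Import Order.TTheory GRing.Theory Num.Theory.
Import numFieldNormedType.Exports.

Local Open Scope classical_set_scope.
Local Open Scope ring_scope.

(** * Simplicial sets: presheaves on the simplex category *)

Definition monotone m n (a : {ffun 'I_m.+1 -> 'I_n.+1}) : bool :=
  [forall i : 'I_m.+1, forall j : 'I_m.+1, (i <= j)%N ==> (a i <= a j)%N].

(* Order-preserving maps [m] -> [n]. *)
Definition Delta m n := {a : {ffun 'I_m.+1 -> 'I_n.+1} | monotone a}.

Lemma monotone_id n : monotone [ffun i : 'I_n.+1 => i].
Proof. by apply/forallP=> i; apply/forallP=> j; rewrite !ffunE implybb. Qed.

Definition did n : Delta n n := exist (@monotone n n) _ (monotone_id n).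

Lemma monotone_comp m n k (b : Delta n k) (a : Delta m n) :
  monotone [ffun i => sval b (sval a i)].
Proof.
apply/forallP=> i; apply/forallP=> j; apply/implyP=> le_ij; rewrite !ffunE.
have /forallP/(_ i)/forallP/(_ j)/implyP/(_ le_ij) le_a := svalP a.
by have /forallP/(_ (sval a i))/forallP/(_ (sval a j))/implyP := svalP b; apply.
Qed.

Definition dcomp m n k (b : Delta n k) (a : Delta m n) : Delta m k :=
  exist (@monotone m k) _ (monotone_comp b a).

Lemma monotone_ordmap m n (a : nat -> nat) :
  {homo a : i j / (i <= j)%N} ->
  monotone [ffun i : 'I_m.+1 => inord (minn (a i) n) : 'I_n.+1].
Proof.
move=> ha; apply/forallP=> i; apply/forallP=> j; apply/implyP=> le_ij.
rewrite !ffunE !inordK ?ltnS ?geq_minr //.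
by rewrite leq_min geq_minr andbT geq_min ha.
Qed.

(* The map i |-> a i from [m] to [n]. The values are truncated at n so that the
   definition is total; every use below has a i <= n on [m]. *)
Definition ordmap m n (a : nat -> nat) (ha : {homo a : i j / (i <= j)%N}) :
  Delta m n := exist (@monotone m n) _ (monotone_ordmap m n ha).

Lemma homo_cst p : {homo (fun _ : nat => p) : i j / (i <= j)%N}.
Proof. by []. Qed.

Lemma homo_id : {homo (fun i : nat => i) : i j / (i <= j)%N}.
Proof. by []. Qed.

Lemma homo_addn p : {homo addn p : i j / (i <= j)%N}.
Proof. by move=> i j; rewrite leq_add2l. Qed.

Lemma homo_bump l : {homo bump l : i j / (i <= j)%N}.
Proof. by move=> i j; rewrite leq_bump2. Qed.

Lemma homo_unbump l : {homo unbump l : i j / (i <= j)%N}.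
Proof.
move=> i j le_ij; rewrite /unbump.
case: (ltnP l i) => li; case: (ltnP l j) => lj.
- exact: leq_sub2r.
- by have := leq_trans li (leq_trans le_ij lj); rewrite ltnn.
- by rewrite subn0 subn1; case: j le_ij lj => // j' _ lj /=; exact: leq_trans li lj.
- by rewrite !subn0.
Qed.

Lemma homo_jump j : {homo (fun i : nat => (j < i)%N : nat) : i k / (i <= k)%N}.
Proof.
move=> i k le_ik; case: (ltnP j i) => // lji.
by rewrite (leq_trans lji le_ik).
Qed.

Record sset := SSet {
  splx :> nat -> Type;
  act : forall m n, Delta m n -> splx n -> splx m;
  act_id : forall n (x : splx n), act (did n) x = x;
  act_comp : forall m n k (b : Delta n k) (a : Delta m n) (x : splx k),
    act a (act b x) = act (dcomp b a) x }.

Record shom (X Y : sset) := SHom {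
  shom_fun :> forall n, X n -> Y n;
  shom_act : forall m n (a : Delta m n) (x : X n),
    shom_fun (act a x) = act a (shom_fun x) }.

Lemma Delta_inj m n (a b : Delta m n) :
  (forall i, sval a i = sval b i :> nat) -> a = b.
Proof. by move=> e; apply/val_inj/ffunP=> i; apply/val_inj/e. Qed.

Lemma dcomp_idr m n (a : Delta m n) : dcomp a (did m) = a.
Proof. by apply: Delta_inj => i; rewrite /= !ffunE. Qed.

Lemma dcompA m n k l (c : Delta k l) (b : Delta n k) (a : Delta m n) :
  dcomp (dcomp c b) a = dcomp c (dcomp b a).
Proof. by apply: Delta_inj => i; rewrite /= !ffunE. Qed.

Definition Delta1 : sset :=
  @SSet (fun n => Delta n 1) (fun m n a b => dcomp b a)
    (fun n a => dcomp_idr a) (fun m n k b a x => dcompA x b a).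

Section Product.
Variables X Y : sset.

Lemma sprod_id n (x : X n * Y n) : (act (did n) x.1, act (did n) x.2) = x.
Proof. by rewrite !act_id; case: x. Qed.

Lemma sprod_comp m n k (b : Delta n k) (a : Delta m n) (x : X k * Y k) :
  (act a (act b x.1), act a (act b x.2)) = (act (dcomp b a) x.1, act (dcomp b a) x.2).
Proof. by rewrite !act_comp. Qed.

Definition sprod : sset :=
  @SSet (fun n => X n * Y n)%type (fun m n a x => (act a x.1, act a x.2))
    sprod_id sprod_comp.

End Product.

Section Operators.
Variables (X : sset) (n : nat).

Definition vertex (p : nat) (s : X n) : X 0 := act (ordmap 0 n (homo_cst p)) s.
Definition firstv (s : X n) : X 0 := vertex 0 s.
Definition lastv (s : X n) : X 0 := vertex n s.
Definition face (l : nat) (s : X n) : X n.-1 := act (ordmap n.-1 n (homo_bump l)) s.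
Definition degen (j : nat) (s : X n) : X n.+1 := act (ordmap n.+1 n (homo_unbump j)) s.
(* s|[v_0 .. v_p] and s|[v_p .. v_n] *)
Definition front (p : nat) (s : X n) : X p := act (ordmap p n homo_id) s.
Definition back (p : nat) (s : X n) : X (n - p)%N :=
  act (ordmap (n - p) n (homo_addn p)) s.

End Operators.

Lemma ordmapE m n (a : nat -> nat) (ha : {homo a : i j / (i <= j)%N}) i :
  sval (ordmap m n ha) i = minn (a i) n :> nat.
Proof. by rewrite ffunE inordK // ltnS geq_minr. Qed.

Lemma vertex_ordmap (X : sset) m n (a : nat -> nat) (ha : {homo a : i j / (i <= j)%N})
    p q (s : X n) :
  minn (a (minn p m)) n = minn q n -> vertex p (act (ordmap m n ha) s) = vertex q s.
Proof.
move=> e; rewrite /vertex act_comp; congr (act _ s); apply: Delta_inj => i.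
by rewrite [sval (dcomp _ _) _]ffunE !ordmapE.
Qed.

Section Vertices.
Variables (X : sset) (n : nat) (s : X n).

Lemma firstv_face l : firstv (face l.+1 s) = firstv s.
Proof. by apply: vertex_ordmap; rewrite min0n. Qed.

Lemma lastv_face (l : 'I_n.-1) : lastv (face l.+1 s) = lastv s.
Proof.
apply: vertex_ordmap; rewrite minnn /bump (ltn_ord l).
by move: l; case: n => [|k] [].
Qed.

Lemma firstv_front p : firstv (front p s) = firstv s.
Proof. by apply: vertex_ordmap; rewrite min0n. Qed.

Lemma lastv_front p : lastv (front p s) = vertex p s.
Proof. by apply: vertex_ordmap; rewrite minnn. Qed.

Lemma firstv_back p : firstv (back p s) = vertex p s.
Proof. by apply: vertex_ordmap; rewrite min0n addn0. Qed.

Lemma lastv_back p : lastv (back p s) = lastv s.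
Proof.
apply: vertex_ordmap; rewrite minnn; case: (leqP p n) => [le_pn|lt_np].
  by rewrite subnKC.
by rewrite minnn; apply/minn_idPr; rewrite (leq_trans (ltnW lt_np)) ?leq_addr.
Qed.

End Vertices.

(** * Simplicial homotopies *)

Definition homotopy (X Y : sset) := shom (sprod X Delta1) Y.

Section Homotopy.
Variables (X Y : sset) (H : homotopy X Y).

(* The n-simplex of Delta[1] constant at the vertex e (e = 0, 1). *)
Definition cst1 n (e : nat) : Delta1 n := ordmap n 1 (homo_cst e).

Lemma hend_act e m n (a : Delta m n) (x : X n) :
  H m (act a x, cst1 m e) = act a (H n (x, cst1 n e)).
Proof.
rewrite -shom_act /=; congr (H m (_, _)); apply: Delta_inj => i.
by rewrite [sval (dcomp _ _) _]ffunE !ordmapE.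
Qed.

(* The restriction of H to the vertex e of Delta[1]. *)
Definition hend (e : nat) : shom X Y :=
  @SHom X Y (fun n x => H n (x, cst1 n e)) (hend_act e).

Definition lambda n (j : nat) : Delta1 n.+1 := ordmap n.+1 1 (homo_jump j).

Definition prism n (j : nat) (s : X n) : Y n.+1 := H n.+1 (degen j s, lambda n j).

Lemma vertex_prism n j e p p' (s : X n) :
  minn (unbump j (minn p n.+1)) n = minn p' n ->
  (j < minn p n.+1)%N = (0 < e)%N ->
  vertex p (prism j s) = hend e 0 (vertex p' s).
Proof.
move=> ep ee; rewrite /prism [LHS]/vertex -shom_act /=; congr (H 0 (_, _)).
  exact: vertex_ordmap.
apply: Delta_inj => i; rewrite [sval (dcomp _ _) _]ffunE !ordmapE ee.
by case: e {ee} => [|[|]].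
Qed.

Lemma firstv_prism n j (s : X n) : firstv (prism j s) = hend 0 0 (firstv s).
Proof. by apply: vertex_prism; rewrite min0n. Qed.

Lemma lastv_prism n (j : 'I_n.+1) (s : X n) :
  lastv (prism j s) = hend 1 0 (lastv s).
Proof.
apply: vertex_prism; rewrite minnn ?ltn_ord //.
by rewrite /unbump ltn_ord subSS subn0.
Qed.

End Homotopy.

(** * Graded maps and cochain complexes *)

Section Graded.
Variable R : realType.

Local Notation gmod := (int -> lmodType R).

(* A graded map is given by all its components V^i -> W^j; it is homogeneous of
   degree k when only the components j = i + k can be nonzero. This way the
   degree identities such as (1 - p) + (1 - r) = 2 - n need no transport. *)
Record gmap (V W : gmod) := GMap {
  component :> forall i j : int, V i -> W j }.

Definition homogeneous (V W : gmod) (k : int) (phi : gmap V W) : Prop :=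
  (forall i j, linear (phi i j)) /\
  (forall i j (v : V i), j != i + k -> phi i j v = 0).

(* psi \o phi, for phi homogeneous of degree k: the only intermediate component
   that contributes to V^i -> W^j is the one of degree i + k. *)
Definition gcomp (U V W : gmod) (k : int) (psi : gmap V W) (phi : gmap U V) :
  gmap U W := GMap (fun i j u => psi (i + k) j (phi i (i + k) u)).

Record cochain := Cochain {
  cmod :> gmod;
  cd : gmap cmod cmod;
  cd_homogeneous : homogeneous 1 cd;
  cd_square : forall i j v, gcomp 1 cd cd i j v = 0 }.

(* Transport of a graded map along equalities of the base points. *)
Definition gcast (A B : Type) (V : A -> gmod) (W : B -> gmod) (x x' : A) (y y' : B)
    (ex : x = x') (ey : y = y') (phi : gmap (V x) (W y)) : gmap (V x') (W y') :=
  match ex in _ = x1, ey in _ = y1 return gmap (V x1) (W y1) with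
  | erefl, erefl => phi
  end.

(* For base points x = y: phi is the identity of V x = V y in each degree. *)
Definition acts_as_id (A : Type) (V : A -> gmod) (x y : A) (phi : gmap (V x) (V y)) :
  Prop :=
  exists e : y = x, forall i v, gcast (V := V) (W := V) erefl e phi i i v = v.

Definition sgn (z : int) : R := (-1) ^ z.

(** * Infinity-local systems *)

(* The map str at n = 0 plays no role: no condition below refers to it. *)
Record ils (Y : sset) := Ils {
  fib : Y 0 -> cochain;
  str : forall n (s : Y n), gmap (fib (lastv s)) (fib (firstv s)) }.

Definition fibm Y (V : ils Y) (y : Y 0) : gmod := fib V y.

Section Structure.
Variables (Y : sset) (V : ils Y) (n : nat) (s : Y n).

Definition str_face (l : 'I_n.-1) : gmap (fib V (lastv s)) (fib V (firstv s)) :=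
  gcast (V := fibm V) (W := fibm V) (lastv_face s l) (firstv_face s l)
    (str V (face l.+1 s)).

Definition str_front (p : nat) : gmap (fib V (vertex p s)) (fib V (firstv s)) :=
  gcast (V := fibm V) (W := fibm V) (lastv_front s p) (firstv_front s p)
    (str V (front p s)).

Definition str_back (p : nat) : gmap (fib V (lastv s)) (fib V (vertex p s)) :=
  gcast (V := fibm V) (W := fibm V) (lastv_back s p) (firstv_back s p)
    (str V (back p s)).

End Structure.

(* The sum over l = 1, ..., n-1 is indexed by l' = l - 1 in 'I_n.-1, and the sum
   over p + r = n by p, with r = n - p. *)
Definition ils_equation Y (V : ils Y) n (s : Y n) : Prop :=
  forall i j (v : fib V (lastv s) i),
    gcomp (1 - n%:Z) (cd (fib V (firstv s))) (str V s) i j v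
    - sgn (1 - n%:Z) *: gcomp 1 (str V s) (cd (fib V (lastv s))) i j v
    + \sum_(l < n.-1) sgn (l.+1 + n)%N *: str_face V s l i j v
    + \sum_(1 <= p < n) sgn (p%:Z * (1 - (n - p)%N%:Z)) *:
        gcomp (1 - (n - p)%N%:Z) (str_front V s p) (str_back V s p) i j v
    = 0.

Record strictly_unital_normalized_ils Y (V : ils Y) : Prop := {
  ils_homogeneous : forall n (s : Y n), (0 < n)%N ->
    homogeneous (1 - n%:Z) (str V s);
  ils_unital : forall y : Y 0, acts_as_id (V := fibm V) (str V (degen 0 y));
  ils_normalized : forall n (s : Y n) (k : nat), (0 < n)%N -> (k <= n)%N ->
    forall i j v, str V (degen k s) i j v = 0;
  ils_closed : forall n (s : Y n), (0 < n)%N -> ils_equation V s }.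

Lemma firstv_shom X Y (f : shom X Y) n (s : X n) : firstv (f n s) = f 0 (firstv s).
Proof. by rewrite /firstv /vertex shom_act. Qed.

Lemma lastv_shom X Y (f : shom X Y) n (s : X n) : lastv (f n s) = f 0 (lastv s).
Proof. by rewrite /lastv /vertex shom_act. Qed.

Definition pullback X Y (f : shom X Y) (V : ils Y) : ils X :=
  @Ils X (fun x => fib V (f 0 x))
    (fun n s => gcast (V := fibm V) (W := fibm V) (lastv_shom f s) (firstv_shom f s)
       (str V (f n s))).

(** * Morphisms *)

Definition mor_family X (V W : ils X) :=
  forall n (s : X n), gmap (fib V (lastv s)) (fib W (firstv s)).

Section Morphism.
Variables (X : sset) (V W : ils X) (a : mor_family V W).

Definition fam_face n (s : X n) (l : 'I_n.-1) :
  gmap (fib V (lastv s)) (fib W (firstv s)) :=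
  gcast (V := fibm V) (W := fibm W) (lastv_face s l) (firstv_face s l)
    (a (face l.+1 s)).

Definition fam_front n (s : X n) (p : nat) :
  gmap (fib V (vertex p s)) (fib W (firstv s)) :=
  gcast (V := fibm V) (W := fibm W) (lastv_front s p) (firstv_front s p)
    (a (front p s)).

Definition fam_back n (s : X n) (p : nat) :
  gmap (fib V (lastv s)) (fib W (vertex p s)) :=
  gcast (V := fibm V) (W := fibm W) (lastv_back s p) (firstv_back s p)
    (a (back p s)).

Definition normalized : Prop :=
  forall n (s : X n) (k : nat), (k <= n)%N ->
    forall i j v, a (degen k s) i j v = 0.

Definition degree_zero : Prop := forall n (s : X n), homogeneous (- n%:Z) (a s).

Definition closed_equation n (s : X n) : Prop :=
  forall i j (v : fib V (lastv s) i),
    sgn n *: (gcomp (- n%:Z) (cd (fib W (firstv s))) (a s) i j v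
              - sgn n *: gcomp 1 (a s) (cd (fib V (lastv s))) i j v)
    + \sum_(l < n.-1) sgn l.+1 *: fam_face s l i j v
    + \sum_(1 <= p < n.+1) sgn ((1 - p%:Z) * (n - p)%N%:Z) *:
        gcomp (- (n - p)%N%:Z) (str_front W s p) (fam_back s p) i j v
    - \sum_(0 <= p < n) sgn (p * (n - p))%N *:
        gcomp (1 - (n - p)%N%:Z) (fam_front s p) (str_back V s p) i j v
    = 0.

Record normalized_closed_morphism : Prop := {
  mor_degree : degree_zero;
  mor_normalized : normalized;
  mor_closed : forall n (s : X n), closed_equation s }.

End Morphism.

Section Transport.
Variables (X Y : sset) (H : homotopy X Y) (V : ils Y).

Definition str_prism n (s : X n) (j : 'I_n.+1) :
  gmap (fib V (hend H 1 0 (lastv s))) (fib V (hend H 0 0 (firstv s))) :=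
  gcast (V := fibm V) (W := fibm V) (lastv_prism H j s) (firstv_prism H j s)
    (str V (prism H j s)).

(* At n = 0 the sum is the single term F_1(h_0 x). *)
Definition htransport : mor_family (pullback (hend H 1) V) (pullback (hend H 0) V) :=
  fun n s => GMap (fun i j v => \sum_(k < n.+1) sgn k *: str_prism s k i j v).

(* Degenerate edges of the homotopy act as the identity, and for a constant
   homotopy the whole morphism is the identity morphism. *)
Definition htransport_strictly_unital : Prop :=
  (forall (x : X 0) (y : Y 0), prism H 0 x = degen 0 y ->
     acts_as_id (V := fibm V) (htransport x)) /\
  (forall phi : shom X Y,
     (forall n (s : X n) (t : Delta1 n), H n (s, t) = phi n s) ->
     (forall x : X 0, acts_as_id (V := fibm V) (htransport x)) /\
     (forall n (s : X n), (0 < n)%N -> forall i j v, htransport s i j v = 0)).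

End Transport.

(** * Smooth manifolds *)

(* Class C^k on the open set U: iterated partial derivatives up to order k exist
   and are continuous on U. *)
Fixpoint Ck m (k : nat) (U : set 'rV[R]_m) (f : 'rV[R]_m -> R) : Prop :=
  (forall x, U x -> {for x, continuous f}) /\
  match k with
  | 0%N => True
  | k'.+1 => forall i : 'I_m,
      (forall x, U x -> derivable f x (delta_mx 0 i)) /\
      Ck k' U (fun x => 'D_(delta_mx 0 i) f x)
  end.

Definition Cinf m (U : set 'rV[R]_m) (f : 'rV[R]_m -> R) : Prop :=
  open U /\ forall k, Ck k U f.

(* coord restricts to a bijection of cdom onto its image, with inverse param. *)
Record chart (T : Type) (m : nat) := Chart {
  cdom : set T;
  coord : T -> 'rV[R]_m;
  param : 'rV[R]_m -> T }.

Definition cimage T m (c : chart T m) (A : set T) : set 'rV[R]_m :=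
  coord c @` (cdom c `&` A).

(* Sets open for the topology determined by an atlas. *)
Definition aopen T m (C : set (chart T m)) (A : set T) : Prop :=
  forall c, C c -> open (cimage c A).

(* A smooth manifold structure on a set, in terms of an atlas; the topology is the
   one for which the charts are homeomorphisms onto open subsets of R^m, and it is
   required to be Hausdorff and second countable (for which it is equivalent that
   countably many charts cover). *)
Record manifold_on (T : Type) := ManifoldOn {
  mdim : nat;
  atlas : set (chart T mdim);
  atlas_cover : forall t, exists2 c, atlas c & cdom c t;
  atlas_param : forall c t, atlas c -> cdom c t -> param c (coord c t) = t;
  atlas_open : forall c, atlas c -> aopen atlas (cdom c);
  atlas_smooth : forall c c', atlas c -> atlas c' -> forall i,
    Cinf (cimage c (cdom c')) (fun x => coord c' (param c x) 0 i);
  atlas_hausdorff : forall s t, s <> t -> exists A B,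
    [/\ aopen atlas A, aopen atlas B, A s, B t & A `&` B = set0];
  atlas_countable : exists C : set (chart T mdim),
    [/\ C `<=` atlas, countable C & forall t, exists2 c, C c & cdom c t] }.

Definition mopen T (M : manifold_on T) (A : set T) : Prop := aopen (atlas (m := M)) A.

Record manifold := Manifold { mcarrier :> Type; mstr :> manifold_on mcarrier }.

Definition smooth_map S T (M : manifold_on S) (N : manifold_on T) (f : S -> T) : Prop :=
  forall c c', atlas (m := M) c -> atlas (m := N) c' ->
    open (cimage c (f @^-1` cdom c')) /\
    forall i, Cinf (cimage c (f @^-1` cdom c'))
                   (fun x => coord c' (f (param c x)) 0 i).

(* Smoothness of a real function on an open subset A. *)
Definition smooth_on S (M : manifold_on S) (A : set S) (f : S -> R) : Prop :=
  forall c, atlas (m := M) c -> Cinf (cimage c A) (f \o param c).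

(** * Diffeologies *)

(* In dfl_local, the condition on A says that the restriction of P to the open
   submanifold A is a plot, tested on the smooth maps into A. *)
Record diffeology (X : Type) := Diffeology {
  plot : forall S : manifold, (S -> X) -> Prop;
  dfl_cst : forall (S : manifold) (x : X), plot (fun _ : S => x);
  dfl_comp : forall (S T : manifold) (u : T -> S) (P : S -> X),
    smooth_map T S u -> plot P -> plot (P \o u);
  dfl_local : forall (S : manifold) (P : S -> X),
    (forall s, exists A, [/\ mopen S A, A s &
       forall (T : manifold) (u : T -> S),
         smooth_map T S u -> (forall t, A (u t)) -> plot (P \o u)]) ->
    plot P }.

Definition plot_map X Y (DX : diffeology X) (DY : diffeology Y) (f : X -> Y) : Prop :=
  forall (S : manifold) (P : S -> X), plot DX P -> plot DY (f \o P).

Record diffeological (X : sset) := Diffeological {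
  dfl :> forall n, diffeology (X n);
  face_smooth : forall n l, (l <= n.+1)%N ->
    plot_map (dfl n.+1) (dfl n) (fun s => face l s);
  degen_smooth : forall n j, (j <= n)%N ->
    plot_map (dfl n) (dfl n.+1) (fun s => degen j s);
  base : manifold_on (X 0);
  base_plot : forall (S : manifold) (P : S -> X 0),
    plot (dfl 0) P <-> smooth_map S base P }.

(* Delta[1]_n carries the discrete diffeology, whose plots are the locally constant
   maps, and X_n * Delta[1]_n the product diffeology. *)
Definition locally_constant (S : manifold) (T : Type) (t : S -> T) : Prop :=
  forall s, exists A, [/\ mopen S A, A s & forall s', A s' -> t s' = t s].

Definition plot_smooth_homotopy X Y (DX : diffeological X) (DY : diffeological Y)
    (H : homotopy X Y) : Prop :=
  forall n (S : manifold) (P : S -> X n) (t : S -> Delta1 n),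
    plot (DX n) P -> locally_constant t -> plot (DY n) (fun s => H n (P s, t s)).

(** * Smooth vector bundles with given fibers *)

Record framing (B : Type) (E : B -> lmodType R) := Framing {
  fidx : Type;
  fdom : fidx -> set B;
  frank : fidx -> nat;
  frame : forall (a : fidx) (b : B), 'I_(frank a) -> E b }.

(* The local frames exhibit the E b as the fibers of a finite-rank smooth vector
   bundle: they cover, are bases of the fibers, and have smooth transitions. *)
Record smooth_bundle B (M : manifold_on B) (E : B -> lmodType R) (Fr : framing E) :
    Prop := {
  frame_cover : forall b, exists a : fidx Fr, fdom a b;
  frame_open : forall a : fidx Fr, mopen M (fdom a);
  frame_basis : forall (a : fidx Fr) b, fdom a b -> forall v : E b,
    exists! c : 'rV[R]_(frank a), v = \sum_k c 0 k *: frame b k;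
  frame_transition : forall a a' : fidx Fr,
    exists2 g : B -> 'M[R]_(frank a, frank a'),
      forall k l, smooth_on M (fdom a `&` fdom a') (fun b => g b k l) &
      forall b, fdom a b -> fdom a' b -> forall l : 'I_(frank a'),
        frame b l = \sum_k g b k l *: frame (a := a) b k }.

(* The family of linear maps phi s : E (u s) -> E' (w s) depends smoothly on s: its
   matrix in local frames is smooth, i.e. it is a smooth section of the bundle
   Hom(u^* E, w^* E') on S. *)
Definition smooth_hom (B B' : Type) (E : B -> lmodType R) (E' : B' -> lmodType R)
    (Fr : framing E) (Fr' : framing E') (S : Type) (M : manifold_on S)
    (u : S -> B) (w : S -> B') (phi : forall s, E (u s) -> E' (w s)) : Prop :=
  forall (a : fidx Fr) (a' : fidx Fr'),
    exists2 g : S -> 'M[R]_(frank a', frank a),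
      forall k l, smooth_on M (u @^-1` fdom a `&` w @^-1` fdom a') (fun s => g s k l) &
      forall s, fdom a (u s) -> fdom a' (w s) -> forall l : 'I_(frank a),
        phi s (frame (u s) l) = \sum_k g s k l *: frame (a := a') (w s) k.

Definition graded_framing X (V : ils X) :=
  forall i : int, framing (fun x : X 0 => fib V x i).

(* All components (i, j) may be required to be smooth, since those off the degree of
   the map vanish. *)
Record smooth_ils Y (DY : diffeological Y) (V : ils Y) (Fr : graded_framing V) : Prop := {
  fib_bounded : exists N : int, forall i, N < `|i| ->
    forall (y : Y 0) (v : fib V y i), v = 0;
  fib_bundle : forall i, smooth_bundle (base DY) (Fr i);
  d_smooth : forall i j,
    smooth_hom (Fr i) (Fr j) (base DY) (u := id) (w := id) (fun y => cd (fib V y) i j);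
  str_smooth : forall n (S : manifold) (P : S -> Y n), (0 < n)%N -> plot (DY n) P ->
    forall i j, smooth_hom (Fr i) (Fr j) S
      (u := fun s => lastv (P s)) (w := fun s => firstv (P s))
      (fun s => str V (P s) i j) }.

Definition raw_plot_smooth X (DX : diffeological X) (V W : ils X)
    (FrV : graded_framing V) (FrW : graded_framing W) (a : mor_family V W) : Prop :=
  forall n (S : manifold) (P : S -> X n), plot (DX n) P ->
    forall i j, smooth_hom (FrV i) (FrW j) S
      (u := fun s => lastv (P s)) (w := fun s => firstv (P s))
      (fun s => a n (P s) i j).

(* The frames of the pullback bundles f^* V^i. *)
Definition pullback_framing X Y (f : shom X Y) (V : ils Y) (Fr : graded_framing V) :
  graded_framing (pullback f V) :=
  fun i => @Framing (X 0) (fun x => fib (pullback f V) x i) (fidx (Fr i))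
    (fun a x => fdom a (f 0 x)) (@frank _ _ (Fr i))
    (fun a x => frame (a := a) (f 0 x)).

End Graded.

(* Main.v *)
(* Multiply the structure equation of V on each prism h_j s by (-1)^(n+j) and sum
   over j. The outer faces of the prisms regroup into the terms q (d_l s), the inner
   faces d_(j+1) h_j s = d_(j+1) h_(j+1) s cancel in pairs, and each product term
   splits h_j s at a vertex before or after the jump of lambda_j, which gives
   f^*F . q or q . g^*F respectively; the sum is the closedness equation of q. *)
Require Import Defs.
From mathcomp Require Import all_boot all_order all_algebra.
From mathcomp Require Import all_classical all_reals all_analysis.
From mathcomp Require Import zify.
Import Defs.

Set Implicit Arguments.
Unset Strict Implicit.
Unset Printing Implicit Defensive.

Import Order.TTheory GRing.Theory Num.Theory.
Import numFieldNormedType.Exports.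

Local Open Scope classical_set_scope.
Local Open Scope ring_scope.

(** * Simplicial identities of the prisms *)

Lemma dcompE m n k (b : Delta n k) (a : Delta m n) i :
  sval (dcomp b a) i = sval b (sval a i).
Proof. exact: ffunE. Qed.

(** Dimensions such as [n.+1 - p] and [(n - p).+1] agree only by a proof, so simplices are compared
    as [Tagged] pairs and monotone maps by their values on natural numbers. *)
Lemma homotopy_simplex_eq (X Y : sset) (H : homotopy X Y) n (s : X n) m m'
    (a : Delta m n) (a' : Delta m' n) (b : Delta m 1) (b' : Delta m' 1) :
  m = m' ->
  (forall k (lt_km : (k < m.+1)%N) (lt_km' : (k < m'.+1)%N),
     sval a (Ordinal lt_km) = sval a' (Ordinal lt_km') :> nat /\
     sval b (Ordinal lt_km) = sval b' (Ordinal lt_km') :> nat) ->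
  Tagged Y (H m (act a s, b)) = Tagged Y (H m' (act a' s, b')).
Proof.
move=> e; case: m' / e in a' b' * => ab.
have -> : a = a' by apply: Delta_inj => -[k lt_km]; case: (ab k lt_km lt_km).
by have -> : b = b' by apply: Delta_inj => -[k lt_km]; case: (ab k lt_km lt_km).
Qed.

Section Prism.
Variables (X Y : sset) (H : homotopy X Y) (n : nat) (s : X n).

(** Every operator is the action of a monotone map, so naturality of [H] moves it onto the
    arguments; comparing the resulting explicit maps is arithmetic. *)
Ltac simplicial :=
  rewrite /prism /hend /face /degen /front /back /lambda /cst1 /=;
  rewrite -?shom_act /= ?act_comp;
  apply: homotopy_simplex_eq => [|i lt_im lt_im'];
  [try lia | rewrite !dcompE !ordmapE /bump /unbump /=; split; lia].

Lemma face_prism_low l j : (l.+1 < j <= n)%N ->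
  Tagged Y (face l.+1 (prism H j s)) = Tagged Y (prism H j.-1 (face l.+1 s)).
Proof. by move=> /andP[lj jn]; simplicial. Qed.

(** The prisms [h_l s] and [h_(l+1) s] differ only at vertex [l+1], which is [(v_l, 1)] in the first
    and [(v_(l+1), 0)] in the second; this face omits it. *)
Lemma face_prism_mid l : (l < n)%N ->
  Tagged Y (face l.+1 (prism H l s)) = Tagged Y (face l.+1 (prism H l.+1 s)).
Proof. by move=> ln; simplicial. Qed.

Lemma face_prism_high l j : (j < l < n)%N ->
  Tagged Y (face l.+1 (prism H j s)) = Tagged Y (prism H j (face l s)).
Proof. by move=> /andP[jl ln]; simplicial. Qed.

(** A cut at a vertex [p <= j] lies before the jump: the front stays at the end 0 and the back keeps
    the jump. A cut at [p.+1] with [j <= p] lies after it; the shift by one accounts for the vertex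
    repeated by [s_j]. *)
Lemma front_prism_low p j : (p <= j <= n)%N ->
  Tagged Y (front p (prism H j s)) = Tagged Y (hend H 0 p (front p s)).
Proof. by move=> /andP[pj jn]; simplicial. Qed.

Lemma back_prism_low p j : (p <= j <= n)%N ->
  Tagged Y (back p (prism H j s)) = Tagged Y (prism H (j - p) (back p s)).
Proof. by move=> /andP[pj jn]; simplicial. Qed.

Lemma front_prism_high p j : (j <= p <= n)%N ->
  Tagged Y (front p.+1 (prism H j s)) = Tagged Y (prism H j (front p s)).
Proof. by move=> /andP[jp pn]; simplicial. Qed.

Lemma back_prism_high p j : (j <= p <= n)%N ->
  Tagged Y (back p.+1 (prism H j s)) = Tagged Y (hend H 1 _ (back p s)).
Proof. by move=> /andP[jp pn]; simplicial. Qed.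

(** The vertices repeated by the degeneracy lie on one side of the jump, so they carry the same
    label and the repetition survives in the prism. *)
Lemma prism_degen_low k j : (j <= k <= n)%N ->
  Tagged Y (prism H j (degen k s)) = Tagged Y (degen k.+1 (prism H j s)).
Proof. by move=> /andP[jk kn]; simplicial. Qed.

Lemma prism_degen_high k j : (k < j <= n.+1)%N ->
  Tagged Y (prism H j (degen k s)) = Tagged Y (degen k (prism H j.-1 s)).
Proof. by move=> /andP[kj jn]; simplicial. Qed.

End Prism.

(** * Signs, and structure maps between freely named fibers *)

Lemma sgnD (R : realType) (a b : int) : sgn R (a + b) = sgn R a * sgn R b.
Proof. by rewrite /sgn expfzDr // oppr_eq0 oner_eq0. Qed.

(** Supplying the half-difference [c] explicitly turns each comparison of signs into an integer
    identity. *)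
Lemma sgn_parity (R : realType) (c a b : int) : a = b + 2 * c -> sgn R a = sgn R b.
Proof.
move=> ->; rewrite sgnD [X in _ * X](_ : _ = 1) ?mulr1 //.
by rewrite /sgn -exprz_exp -[X in (_ ^ X) ^ _]/(Posz 2) -exprnP sqrrN expr1n exp1rz.
Qed.

Section StrAt.
Variables (R : realType) (Y : sset) (V : ils R Y).

(* The structure map of s viewed between the fibers over arbitrary vertices u and w;
   the junk value 0 when these are not the end points of s makes it a total function,
   so that simplices can be rewritten without transporting proofs. *)
Definition str_at (u w : Y 0) n (s : Y n) : gmap (fib V u) (fib V w) :=
  match pselect (lastv s = u), pselect (firstv s = w) with
  | left eu, left ew => gcast (V := fibm V) (W := fibm V) eu ew (str V s)
  | _, _ => GMap (fun i j v => 0)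
  end.

Lemma gcast_str u w n (s : Y n) (eu : lastv s = u) (ew : firstv s = w) :
  gcast (V := fibm V) (W := fibm V) eu ew (str V s) = str_at u w s.
Proof.
rewrite /str_at; case: pselect => // eu'; case: pselect => // ew'.
by rewrite (Prop_irrelevance eu eu') (Prop_irrelevance ew ew').
Qed.

Lemma str_at_tagged u w n (s : Y n) n' (s' : Y n') :
  Tagged Y s = Tagged Y s' -> str_at u w s = str_at u w s'.
Proof. exact: (congr1 (fun t : {n & Y n} => str_at u w (projT2 t))). Qed.

Lemma str_at_homogeneous u w n (s : Y n) :
  strictly_unital_normalized_ils V -> (0 < n)%N -> homogeneous (1 - n%:Z) (str_at u w s).
Proof.
move=> hV n0; rewrite /str_at.
have H0 : homogeneous (1 - n%:Z) (@GMap R (fib V u) (fib V w) (fun i j v => 0)).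
  by split=> // i j k a b; rewrite scaler0 addr0.
case: pselect => // eu; case: pselect => // ew.
by case: _ / eu; case: _ / ew; apply: ils_homogeneous.
Qed.

Lemma str_at_degen u w n (s : Y n) k :
  strictly_unital_normalized_ils V -> (0 < n)%N -> (k <= n)%N ->
  forall i j v, str_at u w (degen k s) i j v = 0.
Proof.
move=> hV n0 kn i j; rewrite /str_at; case: pselect => // eu; case: pselect => // ew.
by case: _ / eu; case: _ / ew; apply: ils_normalized.
Qed.

Lemma str_at_equation u w n (s : Y n) i j (v : fib V u i) :
  strictly_unital_normalized_ils V -> (0 < n)%N -> lastv s = u -> firstv s = w ->
  gcomp (1 - n%:Z) (cd (fib V w)) (str_at u w s) i j v
  - sgn R (1 - n%:Z) *: gcomp 1 (str_at u w s) (cd (fib V u)) i j v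
  + \sum_(l < n.-1) sgn R (l.+1 + n)%N *: str_at u w (face l.+1 s) i j v
  + \sum_(1 <= p < n) sgn R (p%:Z * (1 - (n - p)%N%:Z)) *:
        gcomp (1 - (n - p)%N%:Z) (str_at (vertex p s) w (front p s))
          (str_at u (vertex p s) (back p s)) i j v
  = 0.
Proof.
move=> hV n0 eu ew; case: _ / eu in v *; case: _ / ew.
have := @ils_closed _ _ _ hV n s n0 i j v; rewrite /str_face /str_front /str_back.
rewrite -(gcast_str (erefl (lastv s)) (erefl (firstv s))).
under eq_bigr do rewrite gcast_str.
by under [X in _ + X = 0]eq_bigr do rewrite !gcast_str.
Qed.
End StrAt.

(** * Linear combinations and regrouping of double sums *)

Lemma linear_lincomb (R : realType) (U W : lmodType R) (f : U -> W) m (c : 'I_m -> R)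
    (x : 'I_m -> U) :
  linear f -> f (\sum_k c k *: x k) = \sum_k c k *: f (x k).
Proof.
move=> lf; have f0 : f 0 = 0.
  by rewrite -[X in f X](addNr 0) -scaleN1r lf scaleN1r addNr.
elim: m c x => [|m IH] c x; first by rewrite !big_ord0.
by rewrite !big_ord_recr /= addrC lf IH addrC.
Qed.

Lemma sgnS (R : realType) (n : nat) : sgn R n.+1 = - sgn R n.
Proof. by rewrite -addn1 PoszD sgnD [sgn _ 1]expr1z mulrN1. Qed.

(* A j l and B l k stand for F (d_(l+1) (h_j s)) and F (h_k (d_(l+1) s)). *)
Lemma prism_boundary_sum (R : realType) (M : lmodType R) n (A B : nat -> nat -> M) :
  (forall l j, (l.+1 < j <= n)%N -> A j l = B l j.-1) ->
  (forall l, (l < n)%N -> A l l = A l.+1 l) ->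
  (forall l j, (j < l < n)%N -> A j l = B l.-1 j) ->
  \sum_(j < n.+1) \sum_(l < n) sgn R (j + l)%N *: A j l =
  \sum_(l < n.-1) \sum_(k < n.-1.+1) sgn R (l.+1 + k)%N *: B l k.
Proof.
move=> low mid high.
transitivity (\sum_(0 <= l < n) \sum_(0 <= j < n.+1) sgn R (j + l)%N *: A j l).
  rewrite exchange_big big_mkord; apply: eq_bigr => l _.
  by rewrite big_mkord.
(* For fixed [l], the terms [j < l] are of type [high], [j = l] and [j = l.+1] cancel, and those
   beyond are of type [low] with [k = j.-1], whence the extra sign. *)
transitivity (\sum_(0 <= l < n) (\sum_(0 <= k < l) sgn R (k + l)%N *: B l.-1 k
    + \sum_(l.+1 <= k < n) sgn R (k + l).+1 *: B l k)).
  apply: eq_big_nat => l /andP[_ ln].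
  rewrite (big_cat_nat _ (n := l)) //=; last lia.
  congr (_ + _); first by apply: eq_big_nat => j jl; rewrite high //; lia.
  rewrite big_ltn; last lia.
  rewrite big_ltn; last lia.
  have sgn0 : sgn R (l + l)%N + sgn R (l.+1 + l)%N = 0.
    by rewrite addSn sgnS subrr.
  rewrite addrA mid // -scalerDl sgn0 scale0r add0r big_add1 /=.
  by apply: eq_big_nat => j jl; rewrite low //; lia.
rewrite big_split /=.
case: n => [|n] in low mid high *; first by rewrite !big_nil big_ord0 addr0.
(* The first block is empty at the least [l], the second at the greatest. Without them, and with the
   first shifted by one, the ranges [k <= l] and [k > l] tile the sum over [k]. *)
rewrite big_nat_recl // [X in X + _ + _]big_nil add0r.
rewrite [X in _ + X]big_nat_recr //= [X in _ + (_ + X)]big_geq // addr0.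
rewrite -big_split /= big_mkord; apply: eq_bigr => l _.
rewrite -[RHS](big_mkord xpredT (fun k => sgn R (l.+1 + k)%N *: B l k)).
rewrite [RHS](big_cat_nat _ (n := l.+1)) //=; last first.
  by case: l => l /= ln; lia.
congr (_ + _); apply: eq_bigr => k _; first by rewrite addnC.
by rewrite addSn addnC.
Qed.

(** Here [C j p] is the product term of [h_j s] cut at [p], while [D] and [E] are the terms of
    [f^*F . q] and [q . g^*F]. For each cut the range of [j] is split at [j = p]. *)
Lemma prism_product_sum (M : zmodType) n (C D E : nat -> nat -> M) :
  (forall p j, (p <= j <= n)%N -> C j p = D p (j - p)%N) ->
  (forall p j, (j <= p < n)%N -> C j p.+1 = - E p j) ->
  \sum_(j < n.+1) \sum_(1 <= p < n.+1) C j p =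
  \sum_(1 <= p < n.+1) \sum_(k < (n - p).+1) D p k
  - \sum_(0 <= p < n) \sum_(k < p.+1) E p k.
Proof.
move=> low high; rewrite exchange_big /=.
transitivity (\sum_(1 <= p < n.+1) (\sum_(k < (n - p).+1) D p k
     - \sum_(k < p.-1.+1) E p.-1 k)); last first.
  by rewrite sumrB; congr (_ - _); rewrite big_add1.
apply: eq_big_nat => -[//|p] /andP[_ pn].
rewrite -(big_mkord xpredT (fun j => C j p.+1)) (big_cat_nat _ (n := p.+1)) //=; last lia.
rewrite addrC; congr (_ + _).
  rewrite -{1}[p.+1]add0n big_addn subSn // big_mkord; apply: eq_bigr => k _.
  rewrite low ?addnK //; have := ltn_ord k; lia.
rewrite big_mkord -sumrN; apply: eq_bigr => k _; rewrite high //.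
by have := ltn_ord k; lia.
Qed.

(** * Closedness of [q] *)

Section TransportAt.
Variables (R : realType) (X Y : sset) (H : homotopy X Y) (V : ils R Y).

(** The analogue of [str_at] for [q]: free end points let faces, fronts and backs be handled without
    casts. *)
Definition transport_at (u w : Y 0) n (s : X n) : gmap (fib V u) (fib V w) :=
  GMap (fun i j v => \sum_(k < n.+1) sgn R k *: str_at V u w (prism H k s) i j v).

Lemma gcast_htransport n (s : X n) x y (ex : lastv s = x) (ey : firstv s = y) :
  gcast (V := fibm (pullback (hend H 1) V)) (W := fibm (pullback (hend H 0) V)) ex ey
    (htransport H V s) = transport_at (hend H 1 0 x) (hend H 0 0 y) s.
Proof.
case: _ / ex; case: _ / ey; rewrite /= /htransport /transport_at.
congr GMap; apply: functional_extensionality_dep => i.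
apply: functional_extensionality_dep => j; apply: functional_extensionality_dep => v.
by apply: eq_bigr => k _; rewrite /str_prism gcast_str.
Qed.

Lemma htransportE n (s : X n) :
  htransport H V s = transport_at (hend H 1 0 (lastv s)) (hend H 0 0 (firstv s)) s.
Proof. exact: (gcast_htransport (erefl (lastv s)) (erefl (firstv s))). Qed.

Lemma gcast_pullback_str (f : shom X Y) n (s : X n) x y (ex : lastv s = x)
    (ey : firstv s = y) :
  gcast (V := fibm (pullback f V)) (W := fibm (pullback f V)) ex ey
    (str (pullback f V) s) = str_at V (f 0 x) (f 0 y) (f n s).
Proof. by case: _ / ex; case: _ / ey; rewrite /= gcast_str. Qed.

Hypothesis hV : strictly_unital_normalized_ils V.

Lemma htransport_closed n (s : X n) : closed_equation (htransport H V) s.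
Proof.
move=> i j v.
rewrite /fam_face /fam_front /fam_back /str_front /str_back.
rewrite htransportE.
under eq_bigr do rewrite gcast_htransport.
under [X in _ + X - _]eq_bigr do rewrite gcast_htransport gcast_pullback_str.
under [X in _ - X]eq_bigr do rewrite gcast_htransport gcast_pullback_str.
set u := hend H 1 0 (lastv s) in v *; set w := hend H 0 0 (firstv s).
have dgn : 1 - n.+1%:Z = - n%:Z by lia.
(* [A] and [B] are faces of prisms and prisms of faces; [C] is the product term of the equation on
   [h_a s], already multiplied by [(-1)^(n+a)]; [D] and [E] are the product terms of the closedness
   equation. *)
pose A a l := str_at V u w (face l.+1 (prism H a s)) i j v.
pose B l k := str_at V u w (prism H k (face l.+1 s)) i j v.
pose C a p := sgn R (n + a)%N *: (sgn R (p%:Z * (1 - (n.+1 - p)%N%:Z)) *: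
  gcomp (1 - (n.+1 - p)%N%:Z)
    (str_at V (vertex p (prism H a s)) w (front p (prism H a s)))
    (str_at V u (vertex p (prism H a s)) (back p (prism H a s))) i j v).
pose D (p k : nat) := sgn R ((1 - p%:Z) * (n - p)%N%:Z) *: (sgn R k *:
  gcomp (- (n - p)%N%:Z) (str_at V (hend H 0 0 (vertex p s)) w (hend H 0 p (front p s)))
    (str_at V u (hend H 0 0 (vertex p s)) (prism H k (back p s))) i j v).
pose E (p k : nat) := sgn R (p * (n - p))%N *: (sgn R k *:
  gcomp (1 - (n - p)%N%:Z) (str_at V (hend H 1 0 (vertex p s)) w (prism H k (front p s)))
    (str_at V u (hend H 1 0 (vertex p s)) (hend H 1 (n - p)%N (back p s))) i j v).
have low p a : (p <= a <= n)%N -> C a p = D p (a - p)%N.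
  move=> pan; rewrite /C /D !scalerA -!sgnD.
  rewrite (str_at_tagged _ _ _ (front_prism_low _ _ pan)).
  rewrite (str_at_tagged _ _ _ (back_prism_low _ _ pan)).
  have -> : vertex p (prism H a s) = hend H 0 0 (vertex p s).
    by apply: vertex_prism; rewrite /unbump; lia.
  (* Writing [n = p + m] and [a = p + k] removes truncated subtraction from the exponents, which
     then differ by [2 * p]. *)
  have [m em] : exists m, n = (p + m)%N by exists (n - p)%N; lia.
  have [k ek] : exists k, a = (p + k)%N by exists (a - p)%N; lia.
  have -> : 1 - (n.+1 - p)%N%:Z = - (n - p)%N%:Z by lia.
  congr (_ *: _).
  have -> : (n - p = m)%N by lia.
  have -> : (a - p = k)%N by lia.
  apply: (@sgn_parity _ p%:Z); by rewrite em ek; lia.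
have high p a : (a <= p < n)%N -> C a p.+1 = - E p a.
  move=> apn; have apn' : (a <= p <= n)%N by lia.
  rewrite /C /E !scalerA -!sgnD.
  rewrite (str_at_tagged _ _ _ (front_prism_high _ _ apn')).
  rewrite (str_at_tagged _ _ _ (back_prism_high _ _ apn')).
  have -> : vertex p.+1 (prism H a s) = hend H 1 0 (vertex p s).
    by apply: vertex_prism; rewrite /unbump; lia.
  have [m em] : exists m, n = (p + m)%N by exists (n - p)%N; lia.
  rewrite subSS -scaleNr -PoszD -sgnS; congr (_ *: _).
  have -> : (n - p = m)%N by lia.
  (* The exponents are [2 * p + a - p * m + 1] and [p * m + a + 1]. *)
  apply: (@sgn_parity _ (p%:Z - p%:Z * m%:Z)).
  by rewrite em; lia.
have alow l a : (l.+1 < a <= n)%N -> A a l = B l a.-1.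
  by move=> la; rewrite /A /B (str_at_tagged _ _ _ (face_prism_low _ _ la)).
have amid l : (l < n)%N -> A l l = A l.+1 l.
  by move=> ln; rewrite /A (str_at_tagged _ _ _ (face_prism_mid _ _ ln)).
have ahigh l a : (a < l < n)%N -> A a l = B l.-1 a.
  case: l => [|l]; first by rewrite ltn0.
  by move=> al; rewrite /A /B (str_at_tagged _ _ _ (face_prism_high _ _ al)).
have eqn (k : 'I_n.+1) := @str_at_equation _ _ V u w n.+1 (prism H k s) i j v hV (ltn0Sn n)
  (lastv_prism H k s) (firstv_prism H k s).
(* Zero is expanded into the signed sum of the structure equations on the prisms; the two sides then
   match group by group: two differential terms, faces, products. *)
transitivity (\sum_(k < n.+1) sgn R (n + k)%N *: (0 : fib V w j)); last first.
  by apply: big1 => k _; rewrite scaler0.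
under [RHS]eq_bigr => k _ do rewrite -(eqn k) dgn !scalerDr.
rewrite !big_split /= -!addrA [in LHS]scalerDr -!addrA.
congr (_ + _).
  rewrite /gcomp /= linear_lincomb; last by case: (cd_homogeneous (fib V w)).
  rewrite scaler_sumr; apply: eq_bigr => k _.
  by rewrite scalerA -sgnD PoszD.
congr (_ + _).
  rewrite /gcomp /= scalerN scaler_sumr scaler_sumr -sumrN; apply: eq_bigr => k _.
  rewrite scalerN !scalerA -!sgnD; congr (- (_ *: _)).
  apply: (@sgn_parity _ n%:Z); by rewrite PoszD; lia.
congr (_ + _).
  transitivity (\sum_(l < n.-1) \sum_(k < n.-1.+1) sgn R (l.+1 + k)%N *: B l k).
    apply: eq_bigr => l _; rewrite scaler_sumr; apply: eq_bigr => k _.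
    by rewrite scalerA -sgnD -PoszD.
  rewrite -(prism_boundary_sum alow amid ahigh); apply: eq_bigr => k _.
  rewrite scaler_sumr; apply: eq_bigr => l _; rewrite scalerA -sgnD /A.
  congr (_ *: _); apply/esym/(@sgn_parity _ n.+1%:Z).
  by lia.
transitivity (\sum_(a < n.+1) \sum_(1 <= p < n.+1) C a p); last first.
  by apply: eq_bigr => k _; rewrite scaler_sumr.
rewrite (prism_product_sum low high); congr (_ - _).
  apply: eq_big_nat => p /andP[p0 pn]; rewrite -scaler_sumr; congr (_ *: _).
  (* In [f^*F . q] the sum over prisms is the argument of [F_p], so linearity of [F_p] is used,
     available since [p >= 1]. In [q . g^*F] the sum is outermost. *)
  rewrite /gcomp /= linear_lincomb //.
  exact: (str_at_homogeneous (hend H 0 0 (vertex p s)) w (hend H 0 p (front p s)) hV p0).1.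
by apply: eq_big_nat => p /andP[p0 pn]; rewrite -scaler_sumr.
Qed.
End TransportAt.

(** * Degree, normalization and strict unitality of [q] *)

Section TransportProps.
Variables (R : realType) (X Y : sset) (H : homotopy X Y) (V : ils R Y).
Hypothesis hV : strictly_unital_normalized_ils V.

Lemma htransport_degree : degree_zero (htransport H V).
Proof.
move=> n s; rewrite htransportE.
have str_hom (k : nat) u w := str_at_homogeneous u w (prism H k s) hV (ltn0Sn n).
have dgn : 1 - n.+1%:Z = - n%:Z by lia.
split=> [i j c x y|i j v ij].
  rewrite /= scaler_sumr -big_split; apply: eq_bigr => k _.
  by rewrite (str_hom k _ _).1 scalerDr !scalerA mulrC.
by rewrite /=; apply: big1 => k _; rewrite (str_hom k _ _).2 ?scaler0 // dgn.
Qed.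

(** Each summand vanishes separately: a prism over a degenerate simplex is degenerate of dimension
    at least 2. *)
Lemma htransport_normalized : normalized (htransport H V).
Proof.
move=> n s k kn i j v; rewrite htransportE /=; apply: big1 => -[a a_n] _ /=.
have [ak|ka] := leqP a k.
  by rewrite (str_at_tagged _ _ _ (prism_degen_low H s (_ : a <= k <= n)%N))
    ?str_at_degen ?scaler0 ?ak.
by rewrite (str_at_tagged _ _ _ (prism_degen_high H s (_ : k < a <= n.+1)%N))
  ?str_at_degen ?scaler0 ?ka //; lia.
Qed.

Lemma htransport0E (x : X 0) :
  htransport H V x = str_at V (hend H 1 0 (lastv x)) (hend H 0 0 (firstv x)) (prism H 0 x).
Proof.
rewrite htransportE /transport_at; case E : (str_at _ _ _ _) => [phi].
congr GMap; apply: functional_extensionality_dep => i.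
apply: functional_extensionality_dep => j; apply: functional_extensionality_dep => v.
by rewrite big_ord1 [sgn _ _]expr0z scale1r E.
Qed.

Lemma htransport_unital (x : X 0) (y : Y 0) :
  prism H 0 x = degen 0 y -> acts_as_id (V := fibm V) (htransport H V x).
Proof.
move=> exy; rewrite htransport0E.
(* The end point equalities enter the goal first, so that the prism can be replaced by [degen 0 y]
   inside them and the end points generalized. *)
move: (lastv_prism H (ord0 : 'I_1) x) (firstv_prism H 0 x); rewrite /= exy.
move: (hend H 1 0 (lastv x)) (hend H 0 0 (firstv x)) => u w eu ew.
case: _ / eu; case: _ / ew; rewrite -(gcast_str V (erefl (lastv _)) (erefl (firstv _))).
exact: ils_unital.
Qed.

(** Every prism of a constant homotopy is degenerate, so unitality applies for [n = 0] and
    normalization for [n > 0]. *)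
Lemma htransport_constant (phi : shom X Y) :
  (forall n (s : X n) (t : Delta1 n), H n (s, t) = phi n s) ->
  (forall x : X 0, acts_as_id (V := fibm V) (htransport H V x)) /\
  (forall n (s : X n), (0 < n)%N -> forall i j v, htransport H V s i j v = 0).
Proof.
move=> Hphi; have prismE n (s : X n) k : prism H k s = degen k (phi n s).
  by rewrite /prism Hphi shom_act.
split=> [x|n s n0 i j v]; first exact: htransport_unital (prismE _ x 0%N).
rewrite htransportE /=; apply: big1 => k _.
by rewrite prismE str_at_degen ?scaler0 // -ltnS.
Qed.
End TransportProps.

(** * Smooth dependence on plots *)

Section Smoothness.
Variable R : realType.

(** Continuity and derivatives at a point of an open set only see a neighbourhood inside it, so the
    values outside [U] are irrelevant. *)
Lemma Ck_ext m k (U : set 'rV[R]_m) (f g : 'rV[R]_m -> R) :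
  open U -> (forall x, U x -> f x = g x) -> Ck k U f -> Ck k U g.
Proof.
move=> oU; have near_U h h' x : U x -> (forall y, U y -> h y = h' y :> R) ->
    {near x, h =1 h'}.
  by move=> Ux hh'; apply: filterS hh' _; apply: open_nbhs_nbhs; split.
have continuous_U h h' x : U x -> (forall y, U y -> h y = h' y :> R) ->
    {for x, continuous h} -> {for x, continuous h'}.
  move=> Ux hh' ch; have {}ch : h y @[y --> x] --> h x by exact: ch.
  change (h' y @[y --> x] --> h' x); rewrite -(hh' x Ux).
  exact: (cvg_trans (@near_eq_cvg _ _ (nbhs x) _ _ _ (near_U h h' x Ux hh')) ch).
elim: k f g => [|k IH] f g fg [cf df].
  by split=> // x Ux; exact: (continuous_U f g x Ux fg (cf x Ux)).
split; first by move=> x Ux; exact: (continuous_U f g x Ux fg (cf x Ux)).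
move=> i; have [dfi Cfi] := df i; split=> [x Ux|].
  by apply: near_eq_derivable (dfi x Ux); apply: near_U.
by apply: IH Cfi => x Ux; apply: near_eq_derive; apply: near_U.
Qed.

Lemma Ck_lin m k (U : set 'rV[R]_m) (a : R) (f g : 'rV[R]_m -> R) :
  open U -> Ck k U f -> Ck k U g -> Ck k U (a \*: f + g).
Proof.
move=> oU; have continuous_U (h h' : 'rV[R]_m -> R) x : {for x, continuous h} ->
    {for x, continuous h'} -> {for x, continuous (a \*: h + h')}.
  by move=> ch ch'; apply: (continuousD _ ch'); apply: continuousZ ch; apply: cst_continuous.
elim: k f g => [|k IH] f g [cf df] [cg dg].
  by split=> // x Ux; exact: (continuous_U f g x (cf x Ux) (cg x Ux)).
split; first by move=> x Ux; exact: (continuous_U f g x (cf x Ux) (cg x Ux)).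
move=> i; have [dfi Cfi] := df i; have [dgi Cgi] := dg i; split=> [x Ux|].
  by apply: derivableD; [apply: derivableZ; apply: dfi|apply: dgi].
(* The derivative of the combination is the combination of derivatives only on [U], where
   differentiability is known. *)
apply: Ck_ext (IH _ _ Cfi Cgi) => // x Ux.
by rewrite deriveD ?deriveZ //; [apply: dfi|apply: derivableZ; apply: dfi|apply: dgi].
Qed.

Lemma smooth_on_lincomb (S : Type) (M : manifold_on R S) (A : set S) n
    (c : 'I_n.+1 -> R) (f : 'I_n.+1 -> S -> R) :
  (forall k, smooth_on M A (f k)) -> smooth_on M A (fun s => \sum_k c k * f k s).
Proof.
move=> sf ch hch; have oU := (sf ord0 ch hch).1; split=> // k.
suff: forall r : seq 'I_n.+1, Ck k (cimage ch A)
    ((fun s => \sum_(i <- r) c i * f i s) \o param ch) by [].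
elim=> [|i r IH].
  have [_ Cf0] := sf ord0 ch hch.
  (* The zero function is obtained as [- f ord0 + f ord0]; the nonempty index type provides
     [ord0]. *)
  apply: Ck_ext (Ck_lin (-1) oU (Cf0 k) (Cf0 k)) => // x _.
  rewrite /= big_nil -[LHS]/(-1 * f ord0 (param ch x) + f ord0 (param ch x)).
  by rewrite mulN1r addNr.
have [_ Cfi] := sf i ch hch.
by apply: Ck_ext (Ck_lin (c i) oU (Cfi k) IH) => // x _; rewrite /= big_cons.
Qed.
End Smoothness.

Lemma mopen_setT (R : realType) (S : Type) (M : manifold_on R S) : mopen M setT.
Proof.
by move=> c hc; have := atlas_open hc hc; rewrite /cimage setIid setIT.
Qed.

(** In the pulled-back frames the matrix of [q_n] is the signed sum of the matrices of [F_(n+1)]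
    along the plots formed by the prisms. *)
Lemma htransport_smooth (R : realType) (X Y : sset) (H : homotopy X Y) (V : ils R Y)
    (DX : diffeological R X) (DY : diffeological R Y) (Fr : graded_framing V) :
  plot_smooth_homotopy DX DY H -> smooth_ils DY Fr ->
  raw_plot_smooth DX (pullback_framing (hend H 1) Fr)
    (pullback_framing (hend H 0) Fr) (htransport H V).
Proof.
move=> sH sV n S P pP i j a a'.
change (fidx (Fr i)) in a; change (fidx (Fr j)) in a'.
have pH (k : 'I_n.+1) : plot (DY n.+1) (fun s => prism H k (P s)).
  apply: (sH _ _ (fun s => degen k (P s)) (fun=> lambda n k)).
    by apply: (degen_smooth (d := DX)) pP; rewrite -ltnS.
  by move=> s; exists setT; split=> //; exact: mopen_setT.
pose u s := hend H 1 0 (lastv (P s)); pose w s := hend H 0 0 (firstv (P s)).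
have /choice[g gP] (k : 'I_n.+1) : exists g : S -> 'M[R]_(frank a', frank a),
    (forall r l, smooth_on S (u @^-1` fdom a `&` w @^-1` fdom a') (fun s => g s r l)) /\
    (forall s, fdom a (u s) -> fdom a' (w s) -> forall l,
       str_at V (u s) (w s) (prism H k (P s)) i j (frame (a := a) (u s) l) =
       \sum_r g s r l *: frame (a := a') (w s) r).
  have [g sg eg] := str_smooth sV (ltn0Sn n) (pH k) a a'.
  have eu s : lastv (prism H k (P s)) = u s by exact: lastv_prism.
  have ew s : firstv (prism H k (P s)) = w s by exact: firstv_prism.
  exists g; split.
    (* The domains of smoothness agree because all prisms over [P s] share the end points [u s] and
       [w s]. *)
    move=> r l; move: (sg r l); congr (smooth_on _ (_ `&` _) _).
      by apply: funext => s /=; rewrite eu.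
    by apply: funext => s /=; rewrite ew.
  move=> s; move: (eg s) (eu s) (ew s); move: (u s) (w s) => us ws egs eus ews.
  case: _ / eus; case: _ / ews => ha ha' l.
  by rewrite -(gcast_str V (erefl (lastv _)) (erefl (firstv _))) /= egs.
exists (fun s => \matrix_(r, l) \sum_(k < n.+1) sgn R k * g k s r l).
  move=> r l; under [X in smooth_on _ _ X]eq_fun do rewrite mxE.
  by apply: smooth_on_lincomb => k; exact: (gP k).1.
move=> s ha ha' l; rewrite htransportE /=.
under eq_bigr => k _ do rewrite ((gP k).2 s ha ha') scaler_sumr.
rewrite exchange_big; apply: eq_bigr => r _; rewrite mxE scaler_suml.
by apply: eq_bigr => k _; rewrite scalerA.
Qed.

Theorem lemma5p7 (R : realType) (X Y : sset) (H : homotopy X Y) (V : ils R Y)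
    (hV : strictly_unital_normalized_ils V) :
  normalized_closed_morphism (htransport H V) /\
  htransport_strictly_unital H V /\
  (forall (DX : diffeological R X) (DY : diffeological R Y) (Fr : graded_framing V),
     plot_smooth_homotopy DX DY H -> smooth_ils DY Fr ->
     raw_plot_smooth DX (pullback_framing (hend H 1) Fr)
       (pullback_framing (hend H 0) Fr) (htransport H V)).
Proof.
split.
  split; [exact: htransport_degree|exact: htransport_normalized|].
  by move=> n s; apply: htransport_closed.
split; last exact: htransport_smooth.
split=> [x y|phi]; first exact: htransport_unital.
exact: htransport_constant.
Qed.
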